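(* In all the emission coordinate region $\mathcal{C}$ of a positioning system in Minkowski space-time, the solutions $y$ to the null propagation equations $$(y-e_A)\cdot(y-e_A)=0,\qquad A=1,2,3,4,$$ are real and admit the expression $$y_\pm=y_*+\lambda_\pm\chi,\qquad \lambda_\pm\equiv-\frac{y_*^2}{(\chi\cdot y_* )\pm\sqrt{\Delta}},\qquad \Delta\equiv(\chi\cdot y_* )^2-\chi^2\,y_*^2,$$ where $\chi={*}(e_1\wedge e_2\wedge e_3)$ is the configuration vector and $y_*=\frac{1}{\xi\cdot\chi}\,i(\xi)H$, with $\xi$ a chosen transversal vector, i.e. $\xi\cdot\chi\neq0$. For null configurations, $\chi^2=0$, the sole solution is given by one of these expressions, the other becoming degenerate.
   Context: Minkowski space-time is identified, via a choice of origin of an inertial chart, with a 4-dimensional real oriented and time-oriented vector space with Lorentzian inner product $\cdot$ of signature $2\epsilon$, $\epsilon=\pm1$ fixed ($\epsilon=+1$: $(-,+,+,+)$; $\epsilon=-1$: $(+,-,-,-)$). Write $v^2=v\cdot v$. A time-like or nonzero null vector $v$ is future-pointing iff $\epsilon\,u\cdot v<0$ for a future-pointing time-like $u$. Let $\eta$ be the metric volume form. Conventions: ${*}(v_1\wedge v_2\wedge v_3)$ is the vector $w$ with $w\cdot u=\eta(u,v_1,v_2,v_3)$ for all $u$; ${*}(v_1\wedge v_2)$ is the bivector $B$ with $B(u,w)=\eta(u,w,v_1,v_2)$; $i(\xi)B$ is the vector with $(i(\xi)B)\cdot w=B(\xi,w)$ for all $w$. Positioning system: four distinct smooth future-directed time-like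 curves $\gamma_A(\tau^A)$, $A=1,2,3,4$, parametrized by proper time. The emission region is the set of $x$ for which there are values $\tau^A$ such that each $m_A=x-\gamma_A(\tau^A)$ satisfies $m_A^2=0$ and $\epsilon\,u\cdot m_A<0$ for a future-pointing time-like $u$; the points $\gamma_A=\gamma_A(\tau^A)$ for these values form the configuration of the emitters for $x$. The emission coordinate region $\mathcal{C}$ is the set of such $x$ with $m_1\wedge m_2\wedge m_3\wedge m_4\neq0$. For the configuration of the emitters for an event of $\mathcal{C}$: $e_A=\gamma_A-\gamma_4$ (so $e_4=0$; write $e_a$ for $a=1,2,3$), $\Omega_a=\frac12 e_a^2$, $E^a={*}(e_{a+1}\wedge e_{a+2})$ (indices mod 3), $H=\sum_a\Omega_aE^a$. On $\mathcal{C}$, $\chi\neq0$. The unknown $y$ represents the position $x-\gamma_4$ of the event relative to emitter 4.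
   Formalization: If χ²≠0 but the transversal ξ gives y_*²=0 (e.g. ξ itself a solution y), one λ_± is literally 0/0; there the undefined λ is replaced by its limit as y_*²→0 with χ·y_* and χ² fixed, and the displayed formula for both solutions is asserted only for y_*²≠0. *)

(* Defs.v *)
From HB Require Import structures.
From mathcomp Require Import all_boot all_order all_algebra.
From mathcomp Require Import all_classical all_reals all_analysis.

Set Implicit Arguments.
Unset Strict Implicit.
Unset Printing Implicit Defensive.

Import Order.TTheory GRing.Theory Num.Theory.
Import numFieldNormedType.Exports.

Local Open Scope classical_set_scope.
Local Open Scope ring_scope.

(* The orientation and the time orientation are those of [frame], the
   coordinate frame of an inertial chart: it is orthonormal, positively
   oriented, and its vector of index 0 is time-like and future-pointing. *)
Record minkowski_space (R : realType) (V : vectType R) := MinkowskiSpace {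
  eps : R;
  eps_sign : eps = 1 \/ eps = - 1;
  dot : V -> V -> R;
  dot_linear : forall v, scalar (dot ^~ v);
  dot_sym : commutative dot;
  frame : 4.-tuple V;
  frame_basis : basis_of fullv frame;
  frame_dot : forall i j : 'I_4,
    dot frame`_i frame`_j =
    if i == j then (if i == 0 then - eps else eps) else 0
}.

Section MinkowskiAlgebra.
Context {R : realType} {V : vectType R} (M : minkowski_space V).
Implicit Types (u v w xi y : V) (B : V -> V -> R).

Definition sq v : R := dot M v v.

Definition future_timelike v : Prop :=
  eps M * sq v < 0 /\ eps M * dot M (frame M)`_0 v < 0.

(* The metric volume form: equal to 1 on the positively oriented orthonormal
   frame. *)
Definition eta v1 v2 v3 v4 : R :=
  \det (\matrix_(i < 4, j < 4) coord (frame M) j [:: v1; v2; v3; v4]`_i).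

(* The vector metrically equivalent to a linear form, see [dot_sharp]. *)
Definition sharp (f : V -> R) : V :=
  \sum_(i < 4) (f (frame M)`_i / sq (frame M)`_i) *: (frame M)`_i.

Definition star3 v1 v2 v3 : V := sharp (fun u => eta u v1 v2 v3).

(* Bivectors are seen as bilinear functions on vectors by means of the metric. *)
Definition star2 v1 v2 : V -> V -> R := fun u w => eta u w v1 v2.

Definition contract xi B : V := sharp (B xi).

(* The multivector v_0 /\ v_1 /\ v_2 /\ v_3, also seen as a multilinear
   function of four vectors by means of the metric. *)
Definition wedge4 (v : 'I_4 -> V) : ('I_4 -> V) -> R :=
  fun z => \det (\matrix_(i < 4, j < 4) dot M (z i) (v j)).

Lemma dot_sharp (f : V -> R) : scalar f -> forall u, dot M (sharp f) u = f u.
Proof.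
move=> lf.
have fD u v : f (u + v) = f u + f v by have := lf 1 u v; rewrite scale1r mul1r.
have f0 : f 0 = 0.
  by apply: (addrI (f 0)); rewrite -fD !addr0.
have fZ a u : f (a *: u) = a * f u by have := lf a u 0; rewrite !addr0 f0 addr0.
have dD u v w : dot M (u + v) w = dot M u w + dot M v w.
  by have := dot_linear M w 1 u v; rewrite scale1r mul1r.
have d0 w : dot M 0 w = 0 by apply: (addrI (dot M 0 w)); rewrite -dD !addr0.
have dZ a u w : dot M (a *: u) w = a * dot M u w.
  by have := dot_linear M w a u 0; rewrite !addr0 d0 addr0.
move=> u.
rewrite (coord_basis (frame_basis M) (memvf u)).
have dsum : dot M (sharp f) (\sum_(i < 4) coord (frame M) i u *: (frame M)`_i)
  = \sum_(i < 4) coord (frame M) i u * dot M (sharp f) (frame M)`_i.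
  rewrite dot_sym (big_morph (dot M ^~ (sharp f)) (id1 := 0) (op1 := +%R)) //=.
  by apply: eq_bigr => i _; rewrite dZ dot_sym.
rewrite dsum (big_morph f (id1 := 0) (op1 := +%R)) //=.
apply: eq_bigr => i _; rewrite fZ; congr (_ * _).
rewrite /sharp (big_morph (dot M ^~ _) (id1 := 0) (op1 := +%R)) //=.
rewrite (bigD1 i) //= big1 ?addr0 => [|j ji]; last first.
  by rewrite dZ frame_dot (negbTE ji) mulr0.
rewrite dZ -/(sq _) divfK // /sq frame_dot eqxx.
by case: (eps_sign M) => ->; case: ifP; rewrite ?oppr_eq0 ?oner_eq0.
Qed.

(* Configuration of emitters: the indices A = 1, 2, 3, 4 are the elements
   0, 1, 2, 3 of ['I_4], and the indices a = 1, 2, 3 modulo 3 are the elements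
   0, 1, 2 of ['I_3]. *)
Section Configuration.
Variable e : 'I_4 -> V.

Definition e3 (a : 'I_3) : V := e (widen_ord (leqnSn 3) a).

Definition chi : V := star3 (e3 0) (e3 1) (e3 2%:R).

Definition Omega (a : 'I_3) : R := sq (e3 a) / 2.

Definition E (a : 'I_3) : V -> V -> R := star2 (e3 (a + 1)) (e3 (a + 2%:R)).

Definition H : V -> V -> R := fun u w => \sum_(a < 3) Omega a * E a u w.

Definition ystar xi : V := (dot M xi chi)^-1 *: contract xi H.

Definition null_propagation y : Prop := forall A, sq (y - e A) = 0.

(* The same equations for the vector u + i v of the complexified space:
   vanishing of the real part and of half the imaginary part of the left-hand
   side. *)
Definition null_propagation_complex u v : Prop := forall A,
  sq (u - e A) - sq v = 0 /\ dot M (u - e A) v = 0.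

Definition Delta xi : R :=
  dot M chi (ystar xi) ^+ 2 - sq chi * sq (ystar xi).

(* Signs: [false] stands for + and [true] for -. *)
Definition lambda_den xi (s : bool) : R :=
  dot M chi (ystar xi) + (- 1) ^+ s * Num.sqrt (Delta xi).

Definition lambda xi (s : bool) : R := - sq (ystar xi) / lambda_den xi s.

Definition ysol xi (s : bool) : V := ystar xi + lambda xi s *: chi.

(* [lambda xi s] as a function of the value q of [sq (ystar xi)]. *)
Definition lambda_at xi (s : bool) (q : R) : R :=
  let c := dot M chi (ystar xi) in
  - q / (c + (- 1) ^+ s * Num.sqrt (c ^+ 2 - sq chi * q)).

End Configuration.

Definition chart (c : R -> V) (i : 'I_4) : R -> R :=
  fun t => coord (frame M) i (c t).

Definition velocity (c : R -> V) (t : R) : V :=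
  \sum_(i < 4) ((chart c i)^`())%classic t *: (frame M)`_i.

End MinkowskiAlgebra.

(* Each curve is defined on an open interval of values of its proper time; its
   values outside of it are irrelevant. Curves are distinct when their images
   (the world-lines) are. *)
Record positioning_system (R : realType) (V : vectType R) (M : minkowski_space V) :=
  PositioningSystem {
  gamma : 'I_4 -> R -> V;
  dom : 'I_4 -> set R;
  dom_open : forall A, open (dom A);
  dom_interval : forall A, is_interval (dom A);
  gamma_smooth : forall A i n t, dom A t ->
    derivable ((chart M (gamma A) i)^`(n))%classic t 1;
  gamma_future : forall A t, dom A t ->
    future_timelike M (velocity M (gamma A) t);
  gamma_proper_time : forall A t, dom A t ->
    sq M (velocity M (gamma A) t) = - eps M;
  gamma_distinct : forall A B, A != B ->
    gamma A @` dom A <> gamma B @` dom B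
}.

Section Emission.
Context {R : realType} {V : vectType R} {M : minkowski_space V}.
Variable P : positioning_system M.

Definition mvec (x : V) (tau : 'I_4 -> R) (A : 'I_4) : V :=
  x - gamma P A (tau A).

(* [tau] is the family of proper times at which x receives the signals, so that
   the events [gamma P A (tau A)] form the configuration of the emitters
   for x. *)
Definition emission_times (x : V) (tau : 'I_4 -> R) : Prop :=
  forall A, [/\ dom P A (tau A), sq M (mvec x tau A) = 0 &
    exists2 u, future_timelike M u & eps M * dot M u (mvec x tau A) < 0].

Definition emission_coordinate_region : set V :=
  [set x | exists2 tau, emission_times x tau &
    wedge4 M (mvec x tau) <> (fun=> 0)].

Definition rel_emitters (tau : 'I_4 -> R) (A : 'I_4) : V :=
  gamma P A (tau A) - gamma P ord_max (tau ord_max).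

End Emission.

(* Main.v *)
Require Import Defs.
From mathcomp Require Import all_boot all_order all_algebra.
From mathcomp Require Import all_classical all_reals all_analysis.
From mathcomp Require Import ring lra.
Import Order.TTheory GRing.Theory Num.Theory.
Import numFieldNormedType.Exports.
Local Open Scope classical_set_scope.
Local Open Scope ring_scope.

(* Two points of a world-line differ by a time-like vector, whereas the
   difference of two future-pointing null vectors is never time-like: the
   emission times of an event are unique, so that the condition
   m_1 /\ m_2 /\ m_3 /\ m_4 != 0 holds for [tau]. The equations amount to
   y . e_a = Omega_a together with y^2 = 0; the linear part has the line
   y_* + l chi as solution set, because xi, e_1, e_2, e_3 form a basis, and the
   quadratic one becomes y_*^2 + 2 l (y_* . chi) + l^2 chi^2 = 0. Its
   discriminant Delta equals (chi . y)^2 for every real solution y. The actual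
   position m_4 is one, and chi . m_4 = eta(m_4, m_4 - m_1, m_4 - m_2, m_4 - m_3)
   = eta(m_1, m_2, m_3, m_4) != 0, whence Delta > 0. *)

(** * Expansion of determinants and case analysis on indices *)

Lemma det_mx44 (R : comNzRingType) (f : nat -> nat -> R) :
  let m3 i j k := f 1%N i * (f 2%N j * f 3%N k - f 2%N k * f 3%N j)
     - f 1%N j * (f 2%N i * f 3%N k - f 2%N k * f 3%N i)
     + f 1%N k * (f 2%N i * f 3%N j - f 2%N j * f 3%N i) in
  \det (\matrix_(i < 4, j < 4) f i j) =
  f 0%N 0%N * m3 1%N 2%N 3%N - f 0%N 1%N * m3 0%N 2%N 3%N
  + f 0%N 2%N * m3 0%N 1%N 3%N - f 0%N 3%N * m3 0%N 1%N 2%N.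
Proof.
rewrite /= (expand_det_row _ 0) !big_ord_recl big_ord0.
rewrite /cofactor !(expand_det_row _ 0) !big_ord_recl !big_ord0 /cofactor.
rewrite !(expand_det_row _ 0) !big_ord_recl !big_ord0 /cofactor !det_mx11.
rewrite !mxE /= /bump /= !addn0 !add1n /=.
ring.
Qed.

Lemma ord3_ind (Q : 'I_3 -> Prop) : Q 0 -> Q 1 -> Q 2%:R -> forall a, Q a.
Proof.
move=> Q0 Q1 Q2 [[|[|[|//]]] lt_a].
- by congr Q: Q0; apply/val_inj.
- by congr Q: Q1; apply/val_inj.
- by congr Q: Q2; apply/val_inj.
Qed.

Lemma ord4_ind (Q : 'I_4 -> Prop) :
  (forall a, Q (widen_ord (leqnSn 3) a)) -> Q ord_max -> forall A, Q A.
Proof.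
move=> Qw Qm A; have [A3|] := ltnP A 3.
  by congr Q: (Qw (Ordinal A3)); apply/val_inj.
by move=> A3; congr Q: Qm; apply/val_inj/eqP; rewrite eqn_leq A3 -ltnS ltn_ord.
Qed.

(** * Lorentzian product and volume form in the inertial frame *)

Section Algebra.
Context {R : realType} {V : vectType R} (M : minkowski_space V).
Implicit Types u v w : V.

(* Coordinates indexed by natural numbers, so that sums and determinants over
   ['I_4] expand to expressions accepted by [ring]. *)
Definition co (k : nat) v : R := coord (frame M) (inord k) v.
Arguments co k%_N v.

Lemma coD k u v : co k (u + v) = co k u + co k v.
Proof. by rewrite /co linearD. Qed.

Lemma coZ k a v : co k (a *: v) = a * co k v.
Proof. by rewrite /co linearZ. Qed.

Lemma coN k v : co k (- v) = - co k v.
Proof. by rewrite /co linearN. Qed.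

Definition coE := (coD, coZ, coN).

Lemma eps_mul_eps : eps M * eps M = 1.
Proof. by case: (eps_sign M) => ->; rewrite ?mulrNN mulr1. Qed.

Lemma dotDl u v w : dot M (u + v) w = dot M u w + dot M v w.
Proof. by have := dot_linear M w 1 u v; rewrite scale1r mul1r. Qed.

Lemma dot0l w : dot M 0 w = 0.
Proof. by apply: (addrI (dot M 0 w)); rewrite -dotDl !addr0. Qed.

Lemma dotZl a u w : dot M (a *: u) w = a * dot M u w.
Proof. by have := dot_linear M w a u 0; rewrite !addr0 dot0l addr0. Qed.

Lemma dot_sum_frame (a : 'I_4 -> R) w :
  dot M (\sum_(i < 4) a i *: (frame M)`_i) w =
  \sum_(i < 4) a i * dot M (frame M)`_i w.
Proof.
rewrite (big_morph (dot M ^~ w) (fun u v => dotDl u v w) (dot0l w)).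
by apply: eq_bigr => i _; rewrite dotZl.
Qed.

Lemma dot_coord v w :
  dot M v w = \sum_(i < 4) coord (frame M) i v * dot M (frame M)`_i w.
Proof. by rewrite {1}(coord_basis (frame_basis M) (memvf v)) dot_sum_frame. Qed.

Lemma dot_frame (i : 'I_4) v :
  dot M (frame M)`_i v = (if i == 0 then - eps M else eps M) * co i v.
Proof.
rewrite dot_sym dot_coord.
rewrite (bigD1 i) //= big1 => [|j /negbTE ji]; last first.
  by rewrite frame_dot ji mulr0.
by rewrite frame_dot eqxx addr0 mulrC /co inord_val.
Qed.

Lemma dotE u v : dot M u v =
  eps M * (co 1 u * co 1 v + co 2 u * co 2 v + co 3 u * co 3 v
           - co 0 u * co 0 v).
Proof.
rewrite dot_coord.
under eq_bigr => i _ do rewrite -[i in coord _ i]inord_val -/(co i u) dot_frame.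
by rewrite !big_ord_recl big_ord0 /= /bump /=; ring.
Qed.

Lemma etaE v0 v1 v2 v3 : eta M v0 v1 v2 v3 =
  let m3 i j k := co i v1 * (co j v2 * co k v3 - co k v2 * co j v3)
     - co j v1 * (co i v2 * co k v3 - co k v2 * co i v3)
     + co k v1 * (co i v2 * co j v3 - co j v2 * co i v3) in
  co 0 v0 * m3 1%N 2%N 3%N - co 1 v0 * m3 0%N 2%N 3%N + co 2 v0 * m3 0%N 1%N 3%N
  - co 3 v0 * m3 0%N 1%N 2%N.
Proof.
rewrite /eta -(det_mx44 _ (fun i j => co j [:: v0; v1; v2; v3]`_i)).
by congr (\det _); apply/matrixP => i j; rewrite !mxE /co inord_val.
Qed.

Lemma dot_star3 u v1 v2 v3 : dot M (star3 M v1 v2 v3) u = eta M u v1 v2 v3.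
Proof.
rewrite (@dot_sharp _ _ M (fun u => eta M u v1 v2 v3)) // => a v w.
by rewrite !etaE !coE /=; ring.
Qed.

(** The matrix of products [z i . m j] factors through the frame as a product with the transposed
    coordinate matrix of [m]; if [eta] vanishes, so does every such determinant. *)
Lemma wedge4_eta (m : 'I_4 -> V) : wedge4 M m <> (fun=> 0) ->
  eta M (m 0) (m 1) (m 2%:R) (m 3%:R) != 0.
Proof.
apply: contra_not_neq => eta0; apply/funext => z; rewrite /wedge4.
have -> : \matrix_(i < 4, j < 4) dot M (z i) (m j) =
    \matrix_(i < 4, k < 4) dot M (z i) (frame M)`_k *m
    (\matrix_(i < 4, j < 4)
       coord (frame M) j [:: m 0; m 1; m 2%:R; m 3%:R]`_i)^T.
  apply/matrixP => i j; rewrite !mxE.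
  rewrite dot_sym dot_coord.
  apply: eq_bigr => k _; rewrite !mxE mulrC dot_sym; congr (_ * coord _ _ _).
  by case: j => [[|[|[|[|//]]]] jlt] /=; congr m; apply/val_inj.
by rewrite det_mulmx det_tr -/(eta _ _ _ _ _) eta0 mulr0.
Qed.

(** Nondegeneracy: the coordinate matrix of the four vectors is invertible and sends the column of
    products of [w] with the frame to 0. *)
Lemma eta_orth_eq0 v0 v1 v2 v3 w : eta M v0 v1 v2 v3 != 0 ->
  dot M v0 w = 0 -> dot M v1 w = 0 -> dot M v2 w = 0 -> dot M v3 w = 0 -> w = 0.
Proof.
move=> eta0 w0 w1 w2 w3.
set A := \matrix_(i < 4, j < 4) coord (frame M) j [:: v0; v1; v2; v3]`_i.
have uA : A \in unitmx by rewrite unitmxE unitfE.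
have Aw0 : A *m (\col_j dot M (frame M)`_j w) = 0.
  apply/matrixP => i j; rewrite !mxE.
  transitivity (dot M [:: v0; v1; v2; v3]`_i w).
    by rewrite dot_coord; apply: eq_bigr => k _; rewrite !mxE.
  by case: i => [[|[|[|[|//]]]] ?].
have := congr1 (mulmx (invmx A)) Aw0; rewrite mulKmx // mulmx0.
move=> /matrixP w_frame.
rewrite (coord_basis (frame_basis M) (memvf w)) big1 // => i _.
have := w_frame i 0; rewrite !mxE dot_frame /co inord_val => /eqP.
rewrite mulf_eq0 => /orP[|/eqP ->]; last by rewrite scale0r.
by case: (eps_sign M) => ->; case: ifP; rewrite ?oppr_eq0 oner_eq0.
Qed.

Lemma sq_sub u v : sq M (u - v) = sq M u - 2 * dot M u v + sq M v.
Proof. by rewrite /sq !dotE !coE; ring. Qed.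

End Algebra.

(** * Cauchy-Schwarz inequalities on spatial components *)

Lemma dot3_sq_le (R : realFieldType) (a1 a2 a3 b1 b2 b3 : R) :
  (a1 * b1 + a2 * b2 + a3 * b3) ^+ 2 <=
  (a1 ^+ 2 + a2 ^+ 2 + a3 ^+ 2) * (b1 ^+ 2 + b2 ^+ 2 + b3 ^+ 2).
Proof.
rewrite -subr_ge0.
(* Lagrange's identity: the gap is the squared norm of the cross product. *)
have -> : (a1 ^+ 2 + a2 ^+ 2 + a3 ^+ 2) * (b1 ^+ 2 + b2 ^+ 2 + b3 ^+ 2)
    - (a1 * b1 + a2 * b2 + a3 * b3) ^+ 2 = (a1 * b2 - a2 * b1) ^+ 2
    + (a1 * b3 - a3 * b1) ^+ 2 + (a2 * b3 - a3 * b2) ^+ 2 by ring.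
by rewrite !addr_ge0 ?sqr_ge0.
Qed.

(** Here [s] and [t] stand for the time components of two causal vectors, so that the bound decides
    the sign of their Lorentzian product. *)
Lemma dot3_le (R : realFieldType) (a1 a2 a3 b1 b2 b3 s t : R) :
  0 <= s -> 0 <= t -> a1 ^+ 2 + a2 ^+ 2 + a3 ^+ 2 <= s ^+ 2 ->
  b1 ^+ 2 + b2 ^+ 2 + b3 ^+ 2 <= t ^+ 2 ->
  a1 * b1 + a2 * b2 + a3 * b3 <= s * t.
Proof.
move=> s0 t0 as2 bt2; rewrite leNgt; apply/negP => st_lt.
have : (s * t) ^+ 2 < (a1 * b1 + a2 * b2 + a3 * b3) ^+ 2.
  by rewrite ltr_pXn2r // nnegrE ?(le_trans _ (ltW st_lt)) ?mulr_ge0.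
apply/negP; rewrite -leNgt (le_trans (dot3_sq_le _ _ _ _ _ _ _)) // exprMn.
by rewrite ler_pM ?addr_ge0 ?sqr_ge0.
Qed.

Lemma dot3_lt (R : realFieldType) (a1 a2 a3 b1 b2 b3 s t : R) :
  0 < s -> 0 < t -> a1 ^+ 2 + a2 ^+ 2 + a3 ^+ 2 < s ^+ 2 ->
  b1 ^+ 2 + b2 ^+ 2 + b3 ^+ 2 <= t ^+ 2 ->
  a1 * b1 + a2 * b2 + a3 * b3 < s * t.
Proof.
move=> s0 t0 as2 bt2; rewrite ltNge; apply/negP => st_le.
have : (s * t) ^+ 2 <= (a1 * b1 + a2 * b2 + a3 * b3) ^+ 2.
  have st0 := mulr_ge0 (ltW s0) (ltW t0).
  by rewrite ler_pXn2r // nnegrE // (le_trans _ st_le).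
apply/negP; rewrite -ltNge (le_lt_trans (dot3_sq_le _ _ _ _ _ _ _)) // exprMn.
rewrite (@le_lt_trans _ _ ((a1 ^+ 2 + a2 ^+ 2 + a3 ^+ 2) * t ^+ 2)) //.
  by rewrite ler_wpM2l ?addr_ge0 ?sqr_ge0.
by rewrite ltr_pM2r // exprn_gt0.
Qed.

(** * Signs of products of future-pointing vectors *)

Section Causality.
Context {R : realType} {V : vectType R} (M : minkowski_space V).
Implicit Types u v w m : V.

(** The condition that [emission_times] puts on each [mvec]. *)
Definition future_null m :=
  sq M m = 0 /\ exists2 u, future_timelike M u & eps M * dot M u m < 0.

Lemma eps_dot u v : eps M * dot M u v =
  co M 1 u * co M 1 v + co M 2 u * co M 2 v + co M 3 u * co M 3 v
  - co M 0 u * co M 0 v.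
Proof. by rewrite dotE mulrA eps_mul_eps mul1r. Qed.

Lemma future_timelike_co v : future_timelike M v -> 0 < co M 0 v /\
  co M 1 v ^+ 2 + co M 2 v ^+ 2 + co M 3 v ^+ 2 < co M 0 v ^+ 2.
Proof.
move=> [v2]; have := dot_frame M 0 v => /= ->.
rewrite mulNr mulrN mulrA eps_mul_eps mul1r oppr_lt0 => v0; split=> //.
by move: v2; rewrite /sq eps_dot subr_lt0 -!expr2.
Qed.

Lemma future_null_co m : future_null m -> 0 < co M 0 m /\
  co M 1 m ^+ 2 + co M 2 m ^+ 2 + co M 3 m ^+ 2 = co M 0 m ^+ 2.
Proof.
move=> [m2 [u /future_timelike_co [u0 u2] um]].
have m2E : co M 1 m ^+ 2 + co M 2 m ^+ 2 + co M 3 m ^+ 2 = co M 0 m ^+ 2.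
  apply/eqP; rewrite -subr_eq0; have := eps_dot m m.
  by rewrite -/(sq M m) m2 mulr0 -!expr2 => <-.
split=> //; rewrite ltNge; apply/negP => m0.
move: um; apply/negP; rewrite -leNgt eps_dot.
(* If the time component of [m] were nonpositive, the bound for the spatial parts of [- u] and [m]
   would give [eps * u . m >= 0]. *)
have := @dot3_le _ (- co M 1 u) (- co M 2 u) (- co M 3 u) (co M 1 m)
  (co M 2 m) (co M 3 m) (co M 0 u) (- co M 0 m) (ltW u0).
rewrite oppr_ge0 !sqrrN m2E => /(_ m0 (ltW u2) (lexx _)).
lra.
Qed.

Lemma future_timelike_null v m :
  future_timelike M v -> future_null m -> eps M * dot M v m < 0.
Proof.
move=> /future_timelike_co [v0 v2] /future_null_co [m0 m2].
by rewrite eps_dot subr_lt0 dot3_lt ?m2.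
Qed.

Lemma future_null_null m m' :
  future_null m -> future_null m' -> eps M * dot M m m' <= 0.
Proof.
move=> /future_null_co [m0 m2] /future_null_co [m'0 m'2].
by rewrite eps_dot subr_le0 dot3_le ?m2 ?m'2 // ltW.
Qed.

(** * Uniqueness of the emission times of an event *)

Context (P : positioning_system M).

Lemma dot_gamma_MVT A w s t : dom P A s -> dom P A t -> s < t ->
  exists2 c, dom P A c &
    dot M (gamma P A t) w - dot M (gamma P A s) w =
    dot M (velocity M (gamma P A) c) w * (t - s).
Proof.
move=> ds dt st.
have dI c : c \in `[s, t]%R -> dom P A c.
  rewrite in_itv /=; exact: (dom_interval ds dt).
pose h (i : 'I_4) := dot M (frame M)`_i w.
(* The product with the fixed [w] is a combination of the chart components with constant
   coefficients, which reduces the claim to the scalar mean value theorem. *)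
pose g : R -> R := \sum_(i < 4) (h i \*: chart M (gamma P A) i).
have gE c : g c = dot M (gamma P A c) w.
  by rewrite dot_coord /g fct_sumE; apply: eq_bigr => i _; rewrite mulrC.
have gd c : c \in `[s, t]%R ->
    is_derive c 1 g (dot M (velocity M (gamma P A) c) w).
  move=> cst.
  have -> : dot M (velocity M (gamma P A) c) w =
      \sum_(i < 4) h i *: ((chart M (gamma P A) i)^`())%classic c.
    rewrite /velocity dot_sum_frame; apply: eq_bigr => i _.
    by rewrite mulrC.
  apply: is_derive_sum => i; apply: is_deriveZ; apply: DeriveDef.
    (* The derivative of order 0 is the chart component itself. *)
    exact: (@gamma_smooth _ _ _ P A i 0%N c (dI _ cst)).
  by rewrite derive1E.
have gdo c : c \in `]s, t[%R ->
    is_derive c 1 g (dot M (velocity M (gamma P A) c) w).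
  by move=> cst; exact/gd/subset_itv_oo_cc.
have gc : {within `[s, t], continuous g}.
  by apply: derivable_within_continuous => c /gd [].
have [c cst Ec] := MVT st gdo gc.
exists c; last by rewrite -!gE.
exact/dI/subset_itv_oo_cc.
Qed.

(** With m_s and m_t the two null vectors, the mean value theorem along m_s gives m_t . m_s = - (t -
    s) v . m_s for a velocity v. Times [eps] this is positive if s < t, which two future-pointing
    null vectors forbid. *)
Lemma not_emission_time_lt x A s t : dom P A s -> dom P A t ->
  future_null (x - gamma P A s) -> future_null (x - gamma P A t) -> ~~ (s < t).
Proof.
move=> ds dt ms mt; apply/negP => st.
have [c dc] := dot_gamma_MVT A (x - gamma P A s) s t ds dt st.
have vm := future_timelike_null _ _ (gamma_future dc) ms.
have := future_null_null _ _ mt ms.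
have -> : dot M (x - gamma P A t) (x - gamma P A s) =
   sq M (x - gamma P A s) - (dot M (gamma P A t) (x - gamma P A s)
   - dot M (gamma P A s) (x - gamma P A s)).
  by rewrite /sq !dotE !coE; ring.
move=> + eq_c; rewrite {}eq_c ms.1 sub0r mulrN oppr_le0 mulrA.
by rewrite leNgt nmulr_rlt0 ?subr_gt0 ?st.
Qed.

Lemma emission_times_unique x tau tau' :
  emission_times P x tau -> emission_times P x tau' -> tau = tau'.
Proof.
move=> h h'; apply/funext => A.
have [d m0 mu] := h A; have [d' m0' mu'] := h' A.
have n1 : future_null (mvec P x tau A) by [].
have n2 : future_null (mvec P x tau' A) by [].
by apply/eqP; rewrite eq_le !leNgt !(not_emission_time_lt x A).
Qed.

End Causality.

(** * Reduction of the null propagation equations to a quadratic on a line *)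

Section Configuration.
Context {R : realType} {V : vectType R} (M : minkowski_space V).
Context (e : 'I_4 -> V) (xi : V).
Context (e_max : e ord_max = 0) (xi_chi : dot M xi (chi M e) != 0).
Implicit Types (u v w y : V) (l : R).

(* The coefficients of the quadratic equation for the parameter on the line
   y_* + l chi. *)
Let c := dot M (chi M e) (ystar M e xi).
Let X := sq M (chi M e).
Let q := sq M (ystar M e xi).

Lemma dot_chi u : dot M (chi M e) u = eta M u (e3 e 0) (e3 e 1) (e3 e 2%:R).
Proof. exact: dot_star3. Qed.

Lemma dot_chi_e3 a : dot M (chi M e) (e3 e a) = 0.
Proof. by elim/ord3_ind: a; rewrite dot_chi etaE /=; ring. Qed.

Lemma HE u w : H M e u w =
  Omega M e 0 * eta M u w (e3 e 1) (e3 e 2%:R)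
  + Omega M e 1 * eta M u w (e3 e 2%:R) (e3 e 0)
  + Omega M e 2%:R * eta M u w (e3 e 0) (e3 e 1).
Proof.
rewrite /H /E /star2 !big_ord_recl big_ord0 addr0 addrA; congr (_ + _ + _);
  by congr (Omega M e _ * eta M u w (e3 e _) (e3 e _)); apply/val_inj.
Qed.

Lemma dot_ystar w :
  dot M (ystar M e xi) w = (dot M xi (chi M e))^-1 * H M e xi w.
Proof.
rewrite /ystar dotZl /contract (@dot_sharp _ _ M (H M e xi)) // => a u v.
by rewrite !HE !etaE /= !coE; ring.
Qed.

(** In H(xi, e_a) antisymmetry leaves only the term Omega_a eta(xi, e_a, e_(a+1), e_(a+2)), and this
    [eta] is xi . chi by cyclicity. *)
Lemma dot_ystar_e3 a : dot M (ystar M e xi) (e3 e a) = Omega M e a.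
Proof.
rewrite dot_ystar; apply: (mulfI xi_chi); rewrite mulVKf //.
rewrite dot_sym dot_chi HE.
by elim/ord3_ind: a; rewrite !etaE /=; ring.
Qed.

(** Among the solutions of the linear equations, y_* is thus the one orthogonal to xi; the parameter
    on the line can be read off by a product with xi. *)
Lemma dot_ystar_xi : dot M (ystar M e xi) xi = 0.
Proof. by rewrite dot_ystar HE !etaE /=; ring. Qed.

(** The difference of the two sides is orthogonal to the e_a and to xi, four vectors on which [eta]
    equals xi . chi != 0. *)
Lemma e3_orth_chi w : (forall a, dot M w (e3 e a) = 0) ->
  w = (dot M w xi / dot M xi (chi M e)) *: chi M e.
Proof.
move=> we; apply/eqP; rewrite -subr_eq0; apply/eqP.
have eta0 : eta M xi (e3 e 0) (e3 e 1) (e3 e 2%:R) != 0.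
  by rewrite -dot_chi dot_sym.
have orth a :
    dot M (e3 e a) (w - (dot M w xi / dot M xi (chi M e)) *: chi M e) = 0.
  by rewrite dot_sym dotDl -scaleNr dotZl we dot_chi_e3 mulr0 addr0.
apply: (eta_orth_eq0 _ _ _ _ _ _ eta0) => //.
rewrite dot_sym dotDl -scaleNr dotZl (dot_sym M (chi M e)) mulNr.
by rewrite divfK ?subrr.
Qed.

Lemma affine_solution y : (forall a, dot M y (e3 e a) = Omega M e a) ->
  y = ystar M e xi + (dot M y xi / dot M xi (chi M e)) *: chi M e.
Proof.
move=> ye; have := e3_orth_chi (y - ystar M e xi).
rewrite dotDl -scaleN1r dotZl dot_ystar_xi mulr0 addr0 => <-.
  by rewrite scaleN1r addrC subrK.
by move=> a; rewrite dotDl dotZl dot_ystar_e3 ye mulN1r subrr.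
Qed.

Lemma sq_line l :
  sq M (ystar M e xi + l *: chi M e) = q + 2 * l * c + l ^+ 2 * X.
Proof. by rewrite /q /c /X /sq !dotE !coE; ring. Qed.

Lemma null_propagation_line y : null_propagation M e y <->
  exists2 l, y = ystar M e xi + l *: chi M e & q + 2 * l * c + l ^+ 2 * X = 0.
Proof.
split=> [ny|[l yl ql]].
  have y2 : sq M y = 0 by have := ny ord_max; rewrite e_max subr0.
  have /affine_solution yE a : dot M y (e3 e a) = Omega M e a.
    have := ny (widen_ord (leqnSn 3) a); rewrite sq_sub y2 /Omega /e3.
    by move=> h; lra.
  by exists (dot M y xi / dot M xi (chi M e)); rewrite // -sq_line -yE.
have y2 : sq M y = 0 by rewrite yl sq_line.
elim/ord4_ind => [a|]; last by rewrite e_max subr0.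
rewrite sq_sub y2 -/(e3 e a).
have -> : dot M y (e3 e a) = Omega M e a.
  by rewrite yl dotDl dotZl dot_chi_e3 mulr0 addr0 dot_ystar_e3.
by rewrite /Omega; field.
Qed.

(** Completing the square: Delta = (c + l X)^2 - X (q + 2 l c + l^2 X), where c + l X = chi . y and
    the last factor vanishes at a solution. *)
Lemma Delta_sq_solution y : null_propagation M e y ->
  Delta M e xi = dot M (chi M e) y ^+ 2.
Proof.
move=> /null_propagation_line[l -> ql].
have -> : dot M (chi M e) (ystar M e xi + l *: chi M e) = c + l * X.
  by rewrite /c /X /sq !dotE !coE; ring.
rewrite /Delta -/c -/X -/q.
have -> : q = - (2 * l * c + l ^+ 2 * X) by lra.
by ring.
Qed.

(* A nonzero v would be k chi, with chi . u = 0, and then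
   Delta = (chi . u)^2 - chi^2 u^2 = - (k chi^2)^2 since u^2 = v^2. *)
Lemma null_propagation_real u v : 0 < Delta M e xi ->
  null_propagation_complex M e u v -> v = 0.
Proof.
move=> D0 nuv.
have [] := nuv ord_max; rewrite e_max subr0 => uv2 uv.
have ve a : dot M v (e3 e a) = 0.
  have [_] := nuv (widen_ord (leqnSn 3) a); rewrite dot_sym -/(e3 e a).
  have -> : dot M v (u - e3 e a) = dot M u v - dot M v (e3 e a).
    by rewrite !dotE !coE; ring.
  by rewrite uv; move=> h; lra.
have ue a : dot M u (e3 e a) = Omega M e a.
  have [+ _] := nuv (widen_ord (leqnSn 3) a).
  by rewrite sq_sub /Omega -/(e3 e a) => h; lra.
have := affine_solution _ ue; set l := _ / _ => uE.
have := e3_orth_chi _ ve; set k := _ / _ => vE.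
have [k0|k0] := eqVneq k 0; first by rewrite vE k0 scale0r.
have cu0 : c + l * X = 0.
  apply: (mulfI k0); rewrite mulr0 -uv uE vE /c /X /sq !dotE !coE; ring.
have kX : q + 2 * l * c + l ^+ 2 * X = k ^+ 2 * X.
  have -> : k ^+ 2 * X = sq M v by rewrite vE /X /sq !dotE !coE; ring.
  by rewrite -sq_line -uE; lra.
have DE : Delta M e xi = - (k * X) ^+ 2.
  transitivity ((c + l * X) ^+ 2 - X * (q + 2 * l * c + l ^+ 2 * X)).
    by rewrite /Delta -/c -/X -/q; ring.
  by rewrite cu0 kX; ring.
by move: D0; rewrite DE oppr_gt0 ltNge sqr_ge0.
Qed.

(** * Roots of the quadratic, according to the vanishing of chi^2 and y_*^2 *)

Lemma lambda_den_mul : 0 <= Delta M e xi ->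
  lambda_den M e xi false * lambda_den M e xi true = X * q.
Proof.
move=> D0; rewrite /lambda_den -/c expr0 expr1 mul1r mulN1r.
by rewrite mulrC -subr_sqr sqr_sqrtr // /Delta -/c -/X -/q; ring.
Qed.

Lemma generic_solutions : 0 <= Delta M e xi -> X != 0 -> q != 0 ->
  (forall s, lambda_den M e xi s != 0) /\
  (forall y, null_propagation M e y <->
     y = ysol M e xi false \/ y = ysol M e xi true).
Proof.
move=> D0 X0 q0; have dd := lambda_den_mul D0.
have := mulf_neq0 X0 q0; rewrite -dd mulf_eq0 negb_or => /andP[d0 d1].
have dD : lambda_den M e xi false + lambda_den M e xi true = 2 * c.
  by rewrite /lambda_den -/c expr0 expr1; ring.
(* The denominators have sum 2 c and product X q, so multiplying the quadratic by q splits it into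
   linear factors with roots - q / d. *)
have factor l : q * (q + 2 * l * c + l ^+ 2 * X) =
    (l * lambda_den M e xi false + q) * (l * lambda_den M e xi true + q).
  transitivity (l ^+ 2 * (X * q) + l * (2 * c) * q + q ^+ 2); first by ring.
  by rewrite -dd -dD; ring.
have root l s : lambda_den M e xi s != 0 ->
    l * lambda_den M e xi s + q = 0 <-> l = lambda M e xi s.
  move=> ds; rewrite /lambda -/q.
  split=> [h|->]; last by rewrite divfK // addNr.
  by apply: (mulIf ds); rewrite divfK //; lra.
split=> [[]//|y]; split=> [/null_propagation_line[l -> /eqP]|].
  rewrite -(mulrI_eq0 _ (mulfI q0)) factor mulf_eq0.
  by case/orP => /eqP /root -> //; [left|right].
have sol s : lambda_den M e xi s != 0 -> null_propagation M e (ysol M e xi s).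
  move=> ds; apply/null_propagation_line; exists (lambda M e xi s) => //.
  apply: (mulfI q0); rewrite factor mulr0.
  have /(root _ _ ds) h := erefl (lambda M e xi s).
  by case: s h {ds} => ->; rewrite ?mul0r ?mulr0.
by case=> ->; exact: sol.
Qed.

(** Here Delta = c^2, so the denominators are c + |c| and c - |c|; the boolean [c < 0] selects the
    one equal to 2 c. *)
Lemma lambda_den_degenerate : 0 < Delta M e xi -> X * q = 0 ->
  [/\ c != 0, lambda_den M e xi (c < 0) = 2 * c &
      lambda_den M e xi (~~ (c < 0)) = 0].
Proof.
rewrite /lambda_den /Delta -/c -/X -/q => D0 Xq.
move: D0; rewrite Xq subr0 => c2; rewrite sqrtr_sqr signrN mulNr -numEsign.
by split; [move: c2; rewrite exprn_even_gt0|ring|exact: subrr].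
Qed.

(** The equation degenerates to q + 2 l c = 0, whose root is the expression with denominator 2 c. *)
Lemma null_chi_solutions : 0 < Delta M e xi -> X = 0 ->
  exists s : bool, [/\ lambda_den M e xi s != 0, lambda_den M e xi (~~ s) = 0 &
    forall y, null_propagation M e y <-> y = ysol M e xi s].
Proof.
move=> D0 X0; exists (c < 0).
have [|c0 ds dNs] := lambda_den_degenerate D0; first by rewrite X0 mul0r.
have c20 : 2 * c != 0 by rewrite mulf_neq0 ?pnatr_eq0.
split=> // [|y]; first by rewrite ds.
rewrite null_propagation_line X0 /ysol /lambda ds -/q.
split=> [[l -> ql]|->]; last by exists (- q / (2 * c)) => //; field.
congr (_ + _ *: _); apply: (mulIf c20); rewrite divfK //; lra.
Qed.

Lemma lambda_at_cvg (s : bool) : X != 0 -> c = (-1) ^+ s * `|c| -> c != 0 ->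
  lambda_at M e xi (~~ s) p @[p --> 0^'] --> - (2 * c) / X.
Proof.
move=> X0 sc c0; rewrite /lambda_at -/c -/X /=.
(* Rationalized form: with r the signed root, (c - r)(c + r) = X p turns - p / (c - r) into - (c +
   r) / X, which is continuous at 0, where r = c. *)
pose g p := - (c + (-1) ^+ s * Num.sqrt (c ^+ 2 - X * p)) / X.
have cX : c ^+ 2 - X * p @[p --> (0 : R)] --> c ^+ 2.
  rewrite -[X in _ --> X]subr0 -[X in _ - X](mulr0 X).
  by apply: cvgB; [exact: cvg_cst|apply: cvgMr; exact: cvg_id].
have cg : g p @[p --> (0 : R)] --> - (2 * c) / X.
  have -> : 2 * c = c + (-1) ^+ s * Num.sqrt (c ^+ 2).
    by rewrite sqrtr_sqr -sc; ring.
  apply: cvgMl; apply: cvgN; apply: cvgD; first exact: cvg_cst.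
  by apply: cvgMr; apply: continuous_cvg => //; exact: sqrt_continuous.
have {}cg : g p @[p --> 0^'] --> - (2 * c) / X by exact: cvg_within_filter.
apply: cvg_trans cg; apply: near_eq_cvg.
near=> p.
have p0 : p != 0 by near: p; exact: nbhs_dnbhs_neq.
(* [Num.sqrt] is 0 on negative numbers; since c^2 > 0, the radicand is positive for p near 0. *)
have r2 : Num.sqrt (c ^+ 2 - X * p) ^+ 2 = c ^+ 2 - X * p.
  rewrite sqr_sqrtr // ltW //; near: p; apply: nbhs_dnbhs.
  by apply: (cvgr_gt _ cX); rewrite exprn_even_gt0.
rewrite /g signrN mulNr.
set r := (-1) ^+ s * _.
have {}r2 : r ^+ 2 = c ^+ 2 - X * p by rewrite /r exprMn sqrr_sign mul1r.
have cr : (c - r) * (c + r) = X * p by rewrite -subr_sqr r2; ring.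
have : X * p != 0 by rewrite mulf_neq0.
rewrite -cr mulf_eq0 negb_or => /andP[cr0 _].
apply: (mulIf X0); apply: (mulIf cr0); rewrite divfK //.
by rewrite [RHS]mulrAC divfK // !mulNr (mulrC p) -cr mulrC.
Unshelve. all: by end_near.
Qed.

(** The quadratic becomes l (2 c + l X). The root 0 is the regular expression, and - 2 c / X is the
    limit of the 0/0 one. *)
Lemma null_ystar_solutions : 0 < Delta M e xi -> X != 0 -> q = 0 ->
  exists (s : bool) (l : R),
    [/\ lambda_den M e xi s != 0, lambda_den M e xi (~~ s) = 0,
        lambda_at M e xi (~~ s) p @[p --> 0^'] --> l &
        forall y, null_propagation M e y <->
          y = ysol M e xi s \/ y = ystar M e xi + l *: chi M e].
Proof.
move=> D0 X0 q0; exists (c < 0), (- (2 * c) / X).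
have [|c0 ds dNs] := lambda_den_degenerate D0; first by rewrite q0 mulr0.
split=> // [||y]; first by rewrite ds mulf_neq0 ?pnatr_eq0.
  by apply: lambda_at_cvg => //; exact: numEsign.
rewrite null_propagation_line /ysol /lambda -/q q0 oppr0 mul0r.
split=> [[l -> ql]|[] ->]; last 2 first.
- by exists 0; [by []|ring].
- by exists (- (2 * c) / X); [by []|field].
have /eqP : l * (2 * c + l * X) = 0 by rewrite -ql; ring.
rewrite mulf_eq0 => /orP[]/eqP; [by move->; left|right].
congr (_ + _ *: _); apply: (mulIf X0); rewrite divfK //; lra.
Qed.

End Configuration.

(** * Positivity of Delta from the actual event, and conclusion *)

Theorem theorem1 (R : realType) (V : vectType R) (M : minkowski_space V)
    (P : positioning_system M) (x : V) (tau : 'I_4 -> R) (xi : V)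
    (hx : emission_coordinate_region P x) (htau : emission_times P x tau)
    (hxi : dot M xi (chi M (rel_emitters P tau)) != 0) :
  let e := rel_emitters P tau in
  let ch := chi M e in
  let ys := ystar M e xi in
  [/\ 0 <= Delta M e xi,
      forall u v : V, null_propagation_complex M e u v -> v = 0,
      sq M ch != 0 -> sq M ys != 0 ->
        (forall s : bool, lambda_den M e xi s != 0) /\
        (forall y : V, null_propagation M e y <->
           y = ysol M e xi false \/ y = ysol M e xi true),
      (* one of the expressions of lambda is 0/0: read as a limit *)
      sq M ch != 0 -> sq M ys = 0 ->
        exists (s : bool) (l : R),
          [/\ lambda_den M e xi s != 0, lambda_den M e xi (~~ s) = 0,
              lambda_at M e xi (~~ s) q @[q --> 0^'] --> l &
              forall y : V, null_propagation M e y <->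
                y = ysol M e xi s \/ y = ys + l *: ch] &
      sq M ch = 0 ->
        exists s : bool,
          [/\ lambda_den M e xi s != 0, lambda_den M e xi (~~ s) = 0 &
              forall y : V, null_propagation M e y <-> y = ysol M e xi s]].
Proof.
move=> e ch ys.
have e_max : e ord_max = 0 by exact: subrr.
have [tau' htau'] := hx.
rewrite -(emission_times_unique _ P _ _ _ htau htau') => /wedge4_eta m0.
clear tau' htau' hx.
have mE A : mvec P x tau ord_max - e A = mvec P x tau A.
  by rewrite /mvec /e /rel_emitters opprB addrA subrK.
have ny : null_propagation M e (mvec P x tau ord_max).
  by move=> A; rewrite mE; have [] := htau A.
have eE A : e A = mvec P x tau ord_max - mvec P x tau A.
  by rewrite -(mE A) opprB addrC subrK.
have chi_y : dot M ch (mvec P x tau ord_max) != 0.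
  apply: contraNneq m0; rewrite /ch dot_chi /e3 !eE.
  (* The indices are brought to the numerals used in [m0], so that both sides involve the same
     vectors. *)
  have -> : (ord_max : 'I_4) = 3%:R by apply/val_inj.
  have -> : widen_ord (leqnSn 3) 0 = 0 by apply/val_inj.
  have -> : widen_ord (leqnSn 3) 1 = 1 by apply/val_inj.
  have -> : widen_ord (leqnSn 3) 2%:R = 2%:R by apply/val_inj.
  by move=> <-; apply/eqP; rewrite !etaE /= !coE; ring.
have D0 : 0 < Delta M e xi.
  by rewrite (Delta_sq_solution M e xi e_max hxi _ ny) exprn_even_gt0.
split.
- exact: ltW.
- by move=> u v; apply: (null_propagation_real M e xi).
- by apply: generic_solutions => //; exact: ltW.
- exact: null_ystar_solutions.
- exact: null_chi_solutions.
Qed.
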